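(* Let $C_n(x)$ denote the second-order Eulerian polynomials. For every $n\geqslant 1$, $C_n(x)$ equals the following lower Hessenberg determinant of order $n$: $$C_{n}(x)=\begin{vmatrix} x&-1&0&\cdots&0&0\\ C_1(x)&\binom{2}{1}x&-1&\cdots&0&0\\ C_2(x)&\binom{3}{1}C_1(x)&\binom{3}{2}x&\cdots&0&0\\ \vdots&\vdots&\vdots&\ddots&\ddots&\vdots\\ C_{n-2}(x)&\binom{n-1}{1}C_{n-3}(x)&\binom{n-1}{2}C_{n-4}(x)&\cdots&\binom{n-1}{n-2}x&-1\\ C_{n-1}(x)&\binom{n}{1}C_{n-2}(x)&\binom{n}{2}C_{n-3}(x)&\cdots&\binom{n}{n-2}C_1(x)&\binom{n}{n-1}x \end{vmatrix}_{n\times n},$$ that is, the determinant of the $n\times n$ matrix whose $(i,i)$ entry is $\binom{i}{i-1}x$ for $1\leqslant i\leqslant n$, whose $(i,j)$ entry is $\binom{i}{j-1}C_{i-j}(x)$ for $1\leqslant j<i\leqslant n$, whose $(i,i+1)$ entries are $-1$, and whose $(i,j)$ entries with $j>i+1$ are $0$.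
   Context: The second-order Eulerian polynomials $C_n(x)$ are defined by $C_0(x)=1$ and $C_n(x)=(2n-1)xC_{n-1}(x)+x(1-x)\frac{\mathrm{d}}{\mathrm{d}x}C_{n-1}(x)$ for $n\geqslant 1$; thus $C_1(x)=x$, $C_2(x)=x+2x^2$, $C_3(x)=x+8x^2+6x^3$. Equivalently, $C_n(x)=\sum_{\sigma}x^{\mathrm{des}(\sigma)}$, the sum being over all Stirling permutations $\sigma=\sigma_1\cdots\sigma_{2n}$ of the multiset $\{1,1,2,2,\ldots,n,n\}$ (arrangements in which, for each $i$, all letters between the two occurrences of $i$ are at least $i$), where $\mathrm{des}(\sigma)$ is the number of indices $i\in\{0,1,\ldots,2n\}$ with $\sigma_i>\sigma_{i+1}$, with $\sigma_0=\sigma_{2n+1}=0$. *)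

(* Defs.v *)
From mathcomp Require Import all_boot all_order all_algebra.

Set Implicit Arguments.
Unset Strict Implicit.
Unset Printing Implicit Defensive.

Import GRing.Theory.
Local Open Scope ring_scope.

Fixpoint eulerian2 (n : nat) : {poly int} :=
  if n is m.+1 then
    ((2 * n)%:R - 1) * 'X * eulerian2 m + 'X * (1 - 'X) * (eulerian2 m)^`()
  else 1.

(* Rows and columns are numbered from 0, so the entry of index (i, j) is the
   entry (i + 1, j + 1) in the usual numbering from 1. The diagonal entries
   are multiples of 'X = C_1, not of C_0. *)
Definition eulerian2_hessenberg (n : nat) : 'M[{poly int}]_n :=
  \matrix_(i < n, j < n)
    if j == i :> nat then 'C(i.+1, i)%:R * 'X
    else if (j < i)%N then 'C(i.+1, j)%:R * eulerian2 (i - j)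
    else if j == i.+1 :> nat then - 1
    else 0.

(* Main.v *)
Require Import Defs.
From mathcomp Require Import all_boot all_order all_algebra.
From mathcomp Require Import ring.

Import GRing.Theory.
Local Open Scope ring_scope.

(** Expanding the Hessenberg determinant turns the claim into the recurrence
    C_n = \sum_(j < n) 'C(n, j) C_j e_(n-1-j), with e_0 = x and e_m = C_m for
    m > 0.  With b_0 = 1 and b_(m+1) = - e_m it says that the binomial
    convolution F of C and b satisfies F_n = 0 for n > 0.  The sequences C and b
    satisfy the same type of differential recurrence,
    u_(n+1) = (2 n + c) x u_n + x (1 - x) u_n', with c = 1 and c = - 1; the
    binomial convolution adds the constants c, so F satisfies it with c = 0,
    and F_0 = 1 gives F_1 = 0, hence F_n = 0 for all n > 0. *)

Lemma det_hessenberg (R : comNzRingType) (n : nat) (A : 'M[R]_n.+1)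
    (d : nat -> R) :
    (forall i j : 'I_n.+1, j = i.+1 :> nat -> A i j = - 1) ->
    (forall i j : 'I_n.+1, (i.+1 < j)%N -> A i j = 0) ->
    d 0 = 1 ->
    (forall i : 'I_n.+1,
       d i.+1 = \sum_(j < n.+1 | (j <= i)%N) A i j * d j) ->
  \det A = d n.+1.
Proof.
move=> A1 A0 d0 dS.
(* Right multiplication by the unitriangular U replaces the first column of A
   by A (d 0, ..., d n)^T, whose only nonzero entry is the last one. *)
pose U : 'M[R]_n.+1 := \matrix_(i, j) if j == ord0 then d i else (i == j)%:R.
have detU : \det U = 1.
  rewrite det_trig; last first.
    apply/is_trig_mxP => i j ltij; rewrite mxE -!val_eqE /=.
    by rewrite gtn_eqF ?ltn_eqF // (leq_ltn_trans _ ltij).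
  by apply: big1 => i _; rewrite mxE eqxx; case: eqP => // ->.
have AU0 i : (A *m U) i ord0 = if i == ord_max then d n.+1 else 0.
  rewrite mxE (eq_bigr (fun j : 'I_n.+1 => A i j * d j)); last first.
    by move=> j _; rewrite mxE eqxx.
  rewrite (bigID (fun j : 'I_n.+1 => (j <= i)%N)) /= -dS.
  case: eqP => [-> | /eqP ni].
    by rewrite big1 ?addr0 // => j; rewrite -ltnNge ltnNge -ltnS ltn_ord.
  have lti : (i.+1 < n.+1)%N.
    by rewrite ltnS ltn_neqAle -ltnS ltn_ord andbT.
  rewrite (bigD1 (Ordinal lti)) /= ?ltnn // A1 // big1 ?addr0 ?mulN1r ?subrr //.
  move=> j /andP [ij nj]; rewrite A0 ?mul0r // ltn_neqAle eq_sym.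
  by rewrite ltnNge ij andbT; rewrite -val_eqE in nj.
have AUS i j : j != ord0 -> (A *m U) i j = A i j.
  move=> j0; rewrite mxE (bigD1 j) //= mxE (negPf j0) eqxx mulr1.
  rewrite big1 ?addr0 // => k kj.
  by rewrite mxE (negPf j0) (negPf kj) mulr0.
rewrite -[LHS]mulr1 -detU -det_mulmx (expand_det_col _ ord0) (bigD1 ord_max) //=.
rewrite big1 => [|i ni]; last by rewrite AU0 (negPf ni) mul0r.
(* Deleting the last row and first column leaves a lower triangular minor with diagonal - 1; its
   determinant (-1)^n cancels the cofactor sign. *)
rewrite addr0 AU0 eqxx /cofactor det_trig; last first.
  apply/is_trig_mxP => i j ltij; rewrite mxE mxE AUS ?A0 //.
  by rewrite lift_max lift0.
rewrite (eq_bigr (fun=> - 1)) => [|i _]; last first.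
  by rewrite mxE mxE AUS ?A1 // lift_max lift0.
by rewrite prodr_const card_ord addn0 -exprMn mulrNN mulr1 expr1n mulr1.
Qed.

Definition binomial_conv {R : nzRingType} (u v : nat -> R) (n : nat) : R :=
  \sum_(k < n.+1) 'C(n, k)%:R * (u k * v (n - k)%N).

(** Pascal's rule; this is the product rule for exponential generating functions. *)
Lemma binomial_convS (R : nzRingType) (u v : nat -> R) (n : nat) :
  binomial_conv u v n.+1 =
  \sum_(k < n.+1) 'C(n, k)%:R * (u k.+1 * v (n - k)%N + u k * v (n - k).+1).
Proof.
rewrite /binomial_conv big_ord_recl /= bin0 subn0.
under eq_bigr => i _ do rewrite /bump /= add1n binS natrD mulrDl subSS.
rewrite big_split /=.
under [RHS]eq_bigr => i _ do rewrite mulrDr.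
rewrite [RHS]big_split /= addrA addrC; congr (_ + _).
rewrite big_ord_recr /= bin_small // mul0r addr0.
rewrite [RHS]big_ord_recl /= bin0 subn0; congr (_ + _).
by apply: eq_bigr => i _; rewrite /bump /= add1n subnSK.
Qed.

Lemma binomial_conv_rec {R : comNzRingType} {a b p q : {poly R}}
    {u v : nat -> {poly R}} :
    (forall n, u n.+1 = (n%:R * q + a) * u n + p * (u n)^`()) ->
    (forall n, v n.+1 = (n%:R * q + b) * v n + p * (v n)^`()) ->
  forall n, binomial_conv u v n.+1 =
    (n%:R * q + (a + b)) * binomial_conv u v n
    + p * (binomial_conv u v n)^`().
Proof.
move=> uS vS n; rewrite binomial_convS /binomial_conv raddf_sum !mulr_sumr.
rewrite -big_split /=; apply: eq_bigr => k _.
rewrite [X in X^`()]mulr_natl derivMn derivM -[X in p * X]mulr_natl uS vS.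
(* Splitting n shares [n%:R * q] between the recurrences of [u k] and [v (n - k)]. *)
have -> : n%:R = k%:R + (n - k)%:R :> {poly R}.
  by rewrite -natrD subnKC // -ltnS.
by ring.
Qed.

(** The negated entries of the Hessenberg matrix, preceded by 1: the matrix has
    (i, j) entry - 'C(i.+1, j) * hessenberg_coef (i.+1 - j) for j <= i. *)
Definition hessenberg_coef (n : nat) : {poly int} :=
  match n with
  | 0 => 1
  | 1 => - 'X
  | m.+1 => - eulerian2 m
  end.

Lemma eulerian2_rec (n : nat) :
  eulerian2 n.+1 = (n%:R * (2%:R * 'X) + 'X) * eulerian2 n
                   + 'X * (1 - 'X) * (eulerian2 n)^`().
Proof. by rewrite /= natrM -[n.+1]addn1 natrD; ring. Qed.

Lemma hessenberg_coef_rec (n : nat) :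
  hessenberg_coef n.+1 = (n%:R * (2%:R * 'X) - 'X) * hessenberg_coef n
                         + 'X * (1 - 'X) * (hessenberg_coef n)^`().
Proof.
case: n => [|[|n]].
- by rewrite /= derivC; ring.
- by rewrite /= derivN derivX derivC; ring.
(* From here on the index is shifted by one, and 2 m + 1 = 2 (m + 1) - 1 turns the constant 1 into -
   1. *)
have coefSS m : hessenberg_coef m.+2 = - eulerian2 m.+1 by [].
by rewrite !coefSS eulerian2_rec derivN -[n.+2%:R]natr1; ring.
Qed.

Lemma binomial_conv_eulerian2 (n : nat) :
  binomial_conv eulerian2 hessenberg_coef n.+1 = 0.
Proof.
have FS := binomial_conv_rec eulerian2_rec hessenberg_coef_rec.
elim: n => [|n IHn]; rewrite FS subrr.
  by rewrite /binomial_conv big_ord1 /= bin0 !mulr1 derivC; ring.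
by rewrite IHn deriv0 !mulr0 addr0.
Qed.

Theorem theorem3p1 (n : nat) (hn : (1 <= n)%N) :
  eulerian2 n = \det (eulerian2_hessenberg n).
Proof.
case: n hn => // n _; apply/esym/det_hessenberg => //.
- by move=> i j ij; rewrite mxE ij gtn_eqF // ltnNge leqnSn eqxx.
- move=> i j ij; rewrite mxE gtn_eqF; last exact: ltnW.
  by rewrite ltnNge (ltnW (ltnW ij)) /= gtn_eqF.
move=> i; move: (binomial_conv_eulerian2 i).
(* The last summand is [eulerian2 i.+1], as b_0 = 1; solve for it. *)
rewrite /binomial_conv big_ord_recr /= binn subnn mulr1 mul1r => /eqP.
rewrite addrC addr_eq0 => /eqP ->; rewrite -sumrN.
rewrite (big_ord_widen n.+1 (fun k => - ('C(i.+1, k)%:R *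
  (eulerian2 k * hessenberg_coef (i.+1 - k)))) (ltn_ord i)).
apply: eq_bigr => j; rewrite ltnS => ji; rewrite mxE subSn //.
case: eqP => [-> | /eqP nij]; first by rewrite subnn /=; ring.
have ltji : (j < i)%N by rewrite ltn_neqAle nij.
rewrite ltji; move: ltji; rewrite -subn_gt0.
by case: (i - j)%N => // m _ /=; ring.
Qed.
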